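(* Let $I\in\mathbb{R}$, $\beta>0$, $\tau=e^{-\beta I}$ and $\chi=\tau^2=e^{-2\beta I}$ (the Ising model, $I_m\equiv I$ for all $m\in\mathbf{Z}$). Consider the system of recursive equations $$X^r_{m,n}=X^{r-1}_{m,n-1}+\tau\,Y^r_{m,n-1},\qquad Y^r_{m,n}=Y^r_{m,n-1}+\tau\,X^{r-1}_{m,n-1},$$ for $m,n\in\mathbf{Z}$, $n\ge m+1$, $r=0,1,\dots,n-m+1$, with the conventions $X^r_{m,n}=Y^r_{m,n}=0$ if $r<0$ or $r>n-m+1$, and with the initial values, for all $m\in\mathbf{Z}$, $$X^0_{m,m}=1,\quad X^1_{m,m}=\chi,\quad X^0_{m,m+1}=1,\quad X^1_{m,m+1}=2\chi,\quad X^2_{m,m+1}=\chi.$$ Then the solution of this system depends only on $r$ and on $N=n-m+1$. Writing $X^r_{m,n}=X^r_N$ and $Y^r_{m,n}=Y^r_N$, for every $N\ge 1$ it is given by $X^0_N=1$, $$X^r_N=\sum_{k=1}^r\binom{N-r+1}{k}\binom{r-1}{k-1}\chi^k\qquad (1\le r\le N),$$ $$Y^r_N=\frac{1}{\sqrt{\chi}}\left(X^r_{N+1}-X^{r-1}_N\right)\qquad (0\le r\le N).$$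
   Context: The unknowns are real numbers $X^r_{m,n}$ and $Y^r_{m,n}$, indexed by integers $m\le n$ and $0\le r\le n-m+1$. The values $Y^r_{m,m}$ are not prescribed separately; they are determined by the first equation with $n=m+1$ together with the given initial values of $X$. Binomial coefficients $\binom{a}{b}$ with integers $0\le a<b$ are $0$. In the formula for $Y^0_N$, the convention $X^{-1}_N=0$ is used. *)

(* Defs.v *)
From HB Require Import structures.
From mathcomp Require Import all_boot all_order all_algebra.
From mathcomp Require Import reals sequences exp.

Set Implicit Arguments.
Unset Strict Implicit.
Unset Printing Implicit Defensive.

Import Order.TTheory GRing.Theory Num.Theory.
Local Open Scope ring_scope.

Definition ising_tau (R : realType) (beta I : R) : R := expR (- (beta * I)).

Definition ising_chi (R : realType) (beta I : R) : R := ising_tau beta I ^+ 2.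

(* [X r m n] and [Y r m n] stand for $X^r_{m,n}$ and $Y^r_{m,n}$.  The unknowns
   are only those with m <= n: the values at n < m are junk, left unconstrained.
   The recursion at r = 0 and at r = n - m + 1 uses values outside the index
   range, which [ising_oob] sets to 0. *)
Record ising_solution (R : realType) (beta I : R)
    (X Y : int -> int -> int -> R) : Prop := IsingSolution {
  ising_recX : forall m n r : int, m + 1 <= n -> 0 <= r <= n - m + 1 ->
    X r m n = X (r - 1) m (n - 1) + ising_tau beta I * Y r m (n - 1);
  ising_recY : forall m n r : int, m + 1 <= n -> 0 <= r <= n - m + 1 ->
    Y r m n = Y r m (n - 1) + ising_tau beta I * X (r - 1) m (n - 1);
  ising_oob : forall m n r : int, m <= n -> r < 0 \/ n - m + 1 < r ->
    X r m n = 0 /\ Y r m n = 0;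
  ising_X0mm : forall m : int, X 0 m m = 1;
  ising_X1mm : forall m : int, X 1 m m = ising_chi beta I;
  ising_X0mm1 : forall m : int, X 0 m (m + 1) = 1;
  ising_X1mm1 : forall m : int, X 1 m (m + 1) = 2 * ising_chi beta I;
  ising_X2mm1 : forall m : int, X 2 m (m + 1) = ising_chi beta I
}.

(* Main.v *)
(* The quantity X^r_N = x r N counts words of length N with r ones, weighted by
   chi to the number k of blocks of ones: the ones form a composition of r into
   k parts, and the k blocks are placed in k of the N - r + 1 gaps between zeros.
   Eliminating Y from the system leaves one recurrence for x, which is Pascal's
   rule applied to both factors.  Conversely X at N = 1, 2 determines Y at N = 1,
   after which the system propagates X and Y upwards in N. *)
Require Import Defs.
From HB Require Import structures.
From mathcomp Require Import all_boot all_order all_algebra.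
From mathcomp Require Import reals sequences exp.
From mathcomp Require Import ring zify.

Set Implicit Arguments.
Unset Strict Implicit.
Unset Printing Implicit Defensive.

Import Order.TTheory GRing.Theory Num.Theory.
Local Open Scope ring_scope.

(* Number of compositions of r into k positive parts. *)
Definition ncomp (r k : nat) : nat :=
  match r, k with
  | 0, 0 => 1
  | r.+1, k.+1 => 'C(r, k)
  | _, _ => 0
  end.

Lemma ncompSS (r k : nat) : ncomp r.+1 k.+1 = (ncomp r k.+1 + ncomp r k)%N.
Proof. by case: r k => [|r] [|k] //=; rewrite ?bin0 ?binS. Qed.

Lemma ncomp_small (r k : nat) : (r < k)%N -> ncomp r k = 0%N.
Proof. by case: r k => [|r] [|k] //= rk; rewrite bin_small. Qed.

Section BlockSum.
Context {R : comPzRingType}.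
Variable c : R.

(** [M] stands for the number of gaps, kept independent of [r] so that each binomial factor obeys
    its own Pascal rule. The term k = 0 contributes only for r = 0, where it gives the value 1. *)
Definition block_sum (M r : nat) : R :=
  \sum_(k < r.+1) 'C(M, k)%:R * (ncomp r k)%:R * c ^+ k.

Lemma block_sum0r (M : nat) : block_sum M 0 = 1.
Proof. by rewrite /block_sum big_ord1 /= bin0 expr0 !mulr1. Qed.

Lemma block_sumE (M r : nat) : (0 < r)%N ->
  block_sum M r =
  \sum_(1 <= k < r.+1) 'C(M, k)%:R * 'C(r - 1, k - 1)%:R * c ^+ k.
Proof.
case: r => // r _; rewrite /block_sum big_ord_recl /= mulr0 mul0r add0r.
rewrite big_add1 /= big_mkord; apply: eq_bigr => k _.
by rewrite /= /bump /= !subn1.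
Qed.

Lemma block_sum0l (r : nat) : block_sum 0 r = (r == 0%N)%:R.
Proof.
case: r => [|r]; first by rewrite block_sum0r.
rewrite /block_sum big_ord_recl /= mulr0 mul0r add0r big1 // => k _.
by rewrite !mul0r.
Qed.

Lemma block_sum1l (r : nat) : (0 < r)%N -> block_sum 1 r = c.
Proof.
case: r => // r _; rewrite /block_sum !big_ord_recl /= mulr0 mul0r add0r.
rewrite bin0 big1 ?addr0 ?expr1 ?mul1r // => k _.
by rewrite /= /bump /= bin_small ?mul0r.
Qed.

(** Pascal's rule in the gap count: the new gap holds a block, and the other k blocks lie in the [M]
    old gaps. *)
Lemma block_sumSl (M r : nat) :
  block_sum M.+1 r - block_sum M r =
  \sum_(k < r.+1) 'C(M, k)%:R * (ncomp r k.+1)%:R * c ^+ k.+1.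
Proof.
rewrite /block_sum -sumrB big_ord_recl !bin0 subrr add0r.
rewrite [RHS]big_ord_recr /= ncomp_small // mulr0 mul0r addr0.
apply: eq_bigr => k _; rewrite /= /bump /= add1n binS natrD; ring.
Qed.

(** In the increment from [M] to [M.+1] at [r.+1], [ncompSS] splits every summand in two: one half
    sums to the same increment at [r], the other to [c * block_sum M r]. *)
Lemma block_sumSS (M r : nat) :
  block_sum M.+1 r.+1 - block_sum M.+1 r =
  block_sum M r.+1 - block_sum M r + c * block_sum M r.
Proof.
have SlM : block_sum M.+1 r.+1 - block_sum M r.+1 =
    block_sum M.+1 r - block_sum M r + c * block_sum M r.
  rewrite !block_sumSl big_ord_recr /= (bin_small (ltnSn r)) mulr0 mul0r addr0.
  rewrite {1}/block_sum mulr_sumr -big_split /=; apply: eq_bigr => k _.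
  by rewrite (ncompSS r k : 'C(r, k) = _) natrD exprS; ring.
by move/eqP: SlM; rewrite subr_eq => /eqP ->; ring.
Qed.

End BlockSum.

Lemma subnSn_lt0 (M s : nat) : (M < s)%N -> (M.+1 - s = 0)%N.
Proof. by lia. Qed.

Section ClosedForm.
Context {R : fieldType}.
Variable t : R.

(* Truncated subtraction makes this vanish for r > N, as it should; at N < 0 it
   is junk. *)
Definition xcf (r N : int) : R :=
  if r is Posz s then block_sum (t ^+ 2) (`|N|%N.+1 - s)%N s else 0.

Definition ycf (r N : int) : R := (xcf r (N + 1) - xcf (r - 1) N) / t.

Lemma xcf0 (N : int) : xcf 0 N = 1.
Proof. exact: block_sum0r. Qed.

Lemma xcf_diag (r : int) : 0 < r -> xcf r r = t ^+ 2.
Proof. by case: r => // r r0; rewrite /xcf absz_nat subSnn block_sum1l. Qed.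

Lemma xcf_oob (r N : int) : 0 <= N -> r < 0 \/ N < r -> xcf r N = 0.
Proof.
case: r N => [r|r] [N|N] // _ [] // rN; rewrite /xcf.
by rewrite absz_nat subnSn_lt0 // block_sum0l; case: r rN.
Qed.

Lemma ycf_oob (r N : int) : 0 < N -> r < 0 \/ N < r -> ycf r N = 0.
Proof.
(* At r = N + 1 neither term of the numerator vanishes; both are diagonal values t^2 and cancel.
   This needs N > 0, since [xcf t 0 0] is 1. *)
move=> N0 rN; rewrite /ycf; have [->|rN1] := eqVneq r (N + 1).
  by rewrite addrK !xcf_diag ?subrr ?mul0r //; lia.
by rewrite !xcf_oob ?subrr ?mul0r //; lia.
Qed.

(** This is the second equation of the system, multiplied by t, after Y has been eliminated through
    the first. *)
Lemma xcf_rec (r N : int) : 0 <= N ->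
  xcf r (N + 2) - xcf (r - 1) (N + 1) =
  xcf r (N + 1) - xcf (r - 1) N + t ^+ 2 * xcf (r - 1) N.
Proof.
case: N => // N _; case: r => [[|s]|r]; last 2 first.
- have -> : Posz s.+1 - 1 = s by lia.
  rewrite /xcf -!PoszD !absz_nat !addn1 addn2 !subSS.
  (* In range this is [block_sumSS] with M = N + 1 - s; beyond it every gap count truncates to 0 and
     all terms vanish. *)
  have [sN|Ns] := leqP s N.+1.
    by rewrite (subSn sN) block_sumSS.
  by rewrite !subnSn_lt0 ?(ltnW Ns) // !block_sum0l; case: s Ns => // s _ /=; ring.
- have -> : Negz r - 1 = Negz r.+1 by lia.
  by rewrite /xcf; ring.
- have -> : Posz 0 - 1 = Negz 0 by [].
  by rewrite /xcf !block_sum0r; ring.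
Qed.

Hypothesis t0 : t != 0.

Lemma xcf_recX (r N : int) : xcf r (N + 1) = xcf (r - 1) N + t * ycf r N.
Proof. by rewrite /ycf; field. Qed.

Lemma ycf_recY (r N : int) : 0 <= N ->
  ycf r (N + 1) = ycf r N + t * xcf (r - 1) N.
Proof.
move=> N0; rewrite /ycf -addrA xcf_rec //; by field.
Qed.

End ClosedForm.

Section IsingSolution.
Context {R : realType}.
Variables beta I : R.
Let t := ising_tau beta I.

Let t_gt0 : 0 < t. Proof. exact: expR_gt0. Qed.
Let t_neq0 : t != 0. Proof. exact: lt0r_neq0. Qed.

Lemma ising_solution_closed_form :
  ising_solution beta I (fun r m n => xcf t r (n - m + 1))
                        (fun r m n => ycf t r (n - m + 1)).
Proof.
have x12 : xcf t 1 2 = 2 * t ^+ 2.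
  rewrite -[LHS]/(block_sum (t ^+ 2) 2 1) block_sumE //.
  by rewrite big_nat1 /= bin1 bin0; ring.
split=> [m n r mn _|m n r mn _|m n r mn rmn|m|m|m|m|m].
- have -> : n - m + 1 = (n - 1 - m + 1) + 1 by ring.
  by rewrite xcf_recX.
- have -> : n - m + 1 = (n - 1 - m + 1) + 1 by ring.
  by rewrite ycf_recY //; lia.
- by rewrite xcf_oob ?ycf_oob //; lia.
- by rewrite xcf0.
- by rewrite subrr add0r xcf_diag.
- by rewrite xcf0.
- rewrite (addrC m) addrK; exact: x12.
- rewrite (addrC m) addrK; exact: xcf_diag.
Qed.

Lemma ising_solution_unique (X Y X' Y' : int -> int -> int -> R) :
  ising_solution beta I X Y -> ising_solution beta I X' Y' ->
  forall m n r : int, m <= n -> X r m n = X' r m n /\ Y r m n = Y' r m n.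
Proof.
move=> S S' m n r mn.
have [d ->] : exists d : nat, n = m + d%:Z by exists `|n - m|%N; lia.
elim: d r {n mn} => [|d IHd] r; last first.
  have [r0|rN] := boolP (0 <= r <= m + d.+1%:Z - m + 1); last first.
    have oob : r < 0 \/ m + d.+1%:Z - m + 1 < r by lia.
    have mn : m <= m + d.+1%:Z by lia.
    by case: (ising_oob S mn oob) (ising_oob S' mn oob) => -> -> [-> ->].
  have md : m + 1 <= m + d.+1%:Z by lia.
  rewrite (ising_recX S md r0) (ising_recX S' md r0).
  rewrite (ising_recY S md r0) (ising_recY S' md r0).
  have -> : m + d.+1%:Z - 1 = m + d%:Z by lia.
  by have [_ ->] := IHd r; have [-> _] := IHd (r - 1).
rewrite addr0.
(* Stated for every s, because the recovery of Y below uses it at r - 1. *)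
have eqX s : X s m m = X' s m m.
  have [->|s0] := eqVneq s 0; first by rewrite (ising_X0mm S) (ising_X0mm S').
  have [->|s1] := eqVneq s 1; first by rewrite (ising_X1mm S) (ising_X1mm S').
  have oob : s < 0 \/ m - m + 1 < s by lia.
  by rewrite (ising_oob S _ oob).1 // (ising_oob S' _ oob).1.
split=> //.
have [r01|rN] := boolP (0 <= r <= 1); last first.
  have oob : r < 0 \/ m - m + 1 < r by lia.
  by rewrite (ising_oob S _ oob).2 // (ising_oob S' _ oob).2.
have eqX1 : X r m (m + 1) = X' r m (m + 1).
  have [->|->] : r = 0 \/ r = 1 by lia.
    by rewrite (ising_X0mm1 S) (ising_X0mm1 S').
  by rewrite (ising_X1mm1 S) (ising_X1mm1 S').
have r02 : 0 <= r <= m + 1 - m + 1 by lia.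
(* The first equation at n = m + 1 expresses known X values through tau times Y at (m, m); tau is
   nonzero and cancels. *)
move: eqX1; rewrite (ising_recX S) // (ising_recX S') // addrK eqX.
by move=> /addrI /(mulfI t_neq0).
Qed.

End IsingSolution.

Theorem theorem3p1 (R : realType) (I beta : R) (hbeta : 0 < beta) :
  (exists X Y : int -> int -> int -> R, ising_solution beta I X Y) /\
  (forall X Y : int -> int -> int -> R, ising_solution beta I X Y ->
    exists x y : int -> int -> R,
      (forall m n r : int, m <= n ->
        X r m n = x r (n - m + 1) /\ Y r m n = y r (n - m + 1)) /\
      (forall N : nat, (1 <= N)%N ->
        [/\ x (-1) N%:Z = 0,
            x 0 N%:Z = 1,
            forall r : nat, (1 <= r <= N)%N ->
              x r%:Z N%:Z =
              \sum_(1 <= k < r.+1)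
                'C(N - r + 1, k)%:R * 'C(r - 1, k - 1)%:R
                  * ising_chi beta I ^+ k
          & forall r : nat, (r <= N)%N ->
              y r%:Z N%:Z =
              1 / Num.sqrt (ising_chi beta I)
                * (x r%:Z (N%:Z + 1) - x (r%:Z - 1) N%:Z)])).
Proof.
set t := ising_tau beta I.
have t0 : 0 < t by exact: expR_gt0.
have S0 := ising_solution_closed_form beta I.
split; first by eexists; eexists; exact: S0.
(* The closed form depends on n - m + 1 only, and uniqueness passes this on to X and Y. *)
move=> X Y S; exists (xcf t), (ycf t); split=> [m n r mn|N N1].
  exact: (ising_solution_unique S S0).
split=> [||r /andP[r1 rN]|r rN].
- by rewrite xcf_oob //; left.
- by rewrite xcf0.
- by rewrite /xcf absz_nat block_sumE // subSn // addn1.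
(* The square root of chi is |tau|, which is tau by positivity. *)
- by rewrite /ising_chi sqrtr_sqr gtr0_norm // mul1r mulrC.
Qed.
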